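(* Let $d\ge 1$ and $p\in[0,1]$ with $p_d=\frac{2d+1}{4d}<p\le 1$, let $(S_n)$ be the $d$-dimensional elephant random walk with memory parameter $p$ described in the context, and let $a=\frac{2dp-1}{2d-1}$. Then there is a non-degenerate random vector $L$ in $\mathbb{R}^d$ such that $$\lim_{n\to\infty}\frac{1}{n^a}S_n=L\quad\text{a.s.},$$ and moreover $$\lim_{n\to\infty}\mathbb{E}\Bigl[\Bigl\|\frac{1}{n^a}S_n-L\Bigr\|^2\Bigr]=0.$$
   Context: Multi-dimensional elephant random walk (MERW). Fix a dimension $d\ge1$ and a memory parameter $p\in[0,1]$. Let $(e_1,\dots,e_d)$ be the standard basis of $\mathbb{R}^d$, $I_d$ the $d\times d$ identity matrix, and $J_d$ the $d\times d$ cyclic permutation matrix with entries $(J_d)_{i,i+1}=1$ for $1\le i\le d-1$, $(J_d)_{d,1}=1$, and all other entries $0$. Set $S_0=0$. The first step $X_1$ is uniformly distributed on $\{\pm e_1,\dots,\pm e_d\}$. For $n\ge1$, given $\mathcal{F}_n=\sigma(X_1,\dots,X_n)$, $X_{n+1}=A_nX_{b_n}$, where $b_n$ is uniform on $\{1,\dots,n\}$ and $A_n$ is a random matrix, with $b_n$, $A_n$ independent of each other and of $\mathcal{F}_n$, equal to $I_d$ with probability $p$ and to each of $-I_d,\ \pm J_d,\dots,\pm J_d^{d-1}$ with probability $\frac{1-p}{2d-1}$. The position is $S_n=X_1+\dots+X_n$; $\|\cdot\|$ is the Euclidean norm. *)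

(* Defs.v *)
From HB Require Import structures.
From mathcomp Require Import all_boot all_order all_algebra.
From mathcomp Require Import all_classical all_reals all_analysis.
Set Implicit Arguments. Unset Strict Implicit. Unset Printing Implicit Defensive.
Import Order.TTheory GRing.Theory Num.Theory.
Local Open Scope ring_scope.
Local Open Scope classical_set_scope.

Definition ebasis (R : nzRingType) (d : nat) (i : 'I_d) : 'cV[R]_d :=
  delta_mx i ord0.

Definition pm_basis (R : nzRingType) (d : nat) : set 'cV[R]_d :=
  [set v | exists i : 'I_d, v = ebasis R i \/ v = - ebasis R i].

(* cyclic permutation matrix: (J)_{i,i+1} = 1, (J)_{d,1} = 1 (0-based: j = i+1 mod d) *)
Definition Jmat (R : nzRingType) (d : nat) : 'M[R]_d :=
  \matrix_(i < d, j < d) ((nat_of_ord j == (i.+1 %% d)%N)%:R).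

Definition A_values (R : nzRingType) (d : nat) : set 'M[R]_d :=
  [set M | M = 1%:M \/ M = - 1%:M \/
     exists k : nat, (1 <= k < d)%N /\ (M = Jmat R d ^+ k \/ M = - Jmat R d ^+ k)].

Definition Spos (R : nzRingType) (T : Type) (d : nat) (X : nat -> T -> 'cV[R]_d)
  (n : nat) (w : T) : 'cV[R]_d := \sum_(1 <= i < n.+1) X i w.

(* the history (X_1, ..., X_n), generating F_n *)
Definition hist (R : nzRingType) (T : Type) (d : nat) (X : nat -> T -> 'cV[R]_d)
  (n : nat) (w : T) : 'I_n -> 'cV[R]_d := fun i => X (nat_of_ord i).+1 w.

Arguments ebasis R {d} i.
Arguments pm_basis R d : clear implicits.
Arguments Jmat R d : clear implicits.
Arguments A_values R d : clear implicits.
Arguments hist {R T d} X n w _.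

(* Main.v *)
(* The history (X_1, ..., X_n) takes finitely many values and
   E[X_(n+1) | F_n] = (a / n) S_n, because the terms of E[A_n] in J and - J
   cancel.  Hence M_n = S_n / gamma_n, with
   gamma_n = prod_(1 <= k < n) (1 + a / k), is a martingale whose n-th
   increment has second moment at most gamma_(n+1)^-2.  Since
   n / gamma_n^2 - (n + 1) / gamma_(n+1)^2 >= (2a - 1) / gamma_(n+1)^2 and a > 1/2,
   these bounds are summable, so M_n is bounded in L^2.  Such a
   martingale converges almost surely, by Kolmogorov's maximal inequality
   applied to the stopped increments, and in L^2, by Fatou's lemma.  Finally
   gamma_n / n^a increases to a positive limit, and the limit of M_n is not
   constant since E (M_n - c)^2 >= E (X_1 - c)^2 for every constant c. *)
Require Import Defs.
From HB Require Import structures.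
From mathcomp Require Import all_boot all_order all_algebra.
From mathcomp Require Import all_classical all_reals all_analysis.
From mathcomp Require Import measurable_realfun.
From mathcomp Require Import ring lra.
Set Implicit Arguments. Unset Strict Implicit. Unset Printing Implicit Defensive.
Import Order.TTheory GRing.Theory Num.Theory.
Import numFieldTopology.Exports numFieldNormedType.Exports.
Local Open Scope ring_scope.
Local Open Scope classical_set_scope.

(** Measurability with respect to the sigma-algebra generated by [h], in the form suited to an [h]
    with finitely many values. *)
Definition factors {T S U : Type} (h : T -> S) (f : T -> U) :=
  forall w w', h w = h w' -> f w = f w'.

(** * Random variables determined by a finite-valued one *)

Section finite_valued.
Context {dsp : measure_display} {T : measurableType dsp} {R : realType}.
Variable P : probability T R.
Context {F : finType}.
Variable h : T -> F.
Hypothesis mh : forall x, measurable [set w | h w = x].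

Lemma factors_sum (f : T -> R) : factors h f ->
  exists g : F -> R, f = (fun w => \sum_x g x * \1_[set w | h w = x] w).
Proof.
(* The default 0 of [xget] is met only on an empty fibre of [h], whose indicator vanishes. *)
move=> hf; exists (fun x => xget 0 [set r | exists2 w, h w = x & f w = r]).
apply/funext => w; rewrite (bigD1 (h w))//= big1 ?addr0; last first.
  by move=> x xw; rewrite indicE memNset ?mulr0//= => e; rewrite e eqxx in xw.
rewrite indicE mem_set// mulr1.
case: xgetP => [r _ [w' e <-]|/(_ (f w))[]]; first exact: hf.
by exists w.
Qed.

Lemma integrable_factors (f : T -> R) : factors h f ->
  P.-integrable setT (EFin \o f).
Proof.
move=> /factors_sum[g ->].
rewrite (_ : _ \o _ =
  fun w => (\sum_x (g x)%:E * (\1_[set w | h w = x] w)%:E)%E); last first.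
  by apply/funext => w /=; rewrite -sumEFin.
by apply: integrable_sum => // x _; apply: integrableZl => //;
  exact: integrable_indic.
Qed.

Lemma Rintegral_sum (I : Type) (s : seq I) (f : I -> T -> R) :
  (forall i, P.-integrable setT (EFin \o f i)) ->
  \int[P]_w (\sum_(i <- s) f i w) = \sum_(i <- s) \int[P]_w f i w.
Proof.
move=> intf; elim: s => [|i s ih].
  rewrite big_nil -[RHS](mul0r (fine (P setT))) -Rintegral_cst//.
  by apply: eq_Rintegral => w _; rewrite big_nil.
rewrite big_cons -ih -RintegralD//.
  by apply: eq_Rintegral => w _; rewrite big_cons.
rewrite (_ : _ \o _ = fun w => (\sum_(i <- s) (EFin \o f i) w)%E).
  exact: integrable_sum.
by apply/funext => w /=; rewrite sumEFin.
Qed.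

Lemma Rintegral_indic (A : set T) : measurable A ->
  \int[P]_w (\1_A w) = fine (P A).
Proof. by move=> mA; rewrite /Rintegral integral_indic// setIT. Qed.

Let mAh (A : set T) x : measurable A -> measurable (A `&` [set w | h w = x]).
Proof. by move=> mA; exact: measurableI. Qed.

Let indicM_sum (A : set T) (g : F -> R) :
  (fun w => \1_A w * \sum_x g x * \1_[set w | h w = x] w) =
  (fun w => \sum_x g x * \1_(A `&` [set w | h w = x]) w).
Proof.
apply/funext => w; rewrite mulr_sumr; apply: eq_bigr => x _.
by rewrite mulrCA indicI.
Qed.

Let integrable_Zindic (A : set T) (r : R) : measurable A ->
  P.-integrable setT (EFin \o fun w => r * \1_A w).
Proof.
move=> mA; rewrite (_ : _ \o _ = fun w => (r%:E * (\1_A w)%:E)%E)//.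
by apply: integrableZl => //; exact: integrable_indic.
Qed.

Lemma integrable_indicM (A : set T) (f : T -> R) : measurable A ->
  factors h f -> P.-integrable setT (EFin \o fun w => \1_A w * f w).
Proof.
move=> mA /factors_sum[g ->]; rewrite indicM_sum.
rewrite (_ : _ \o _ =
  fun w => (\sum_x (EFin \o fun w =>
    g x * \1_(A `&` [set w | h w = x]) w)%R w)%E); last first.
  by apply/funext => w /=; rewrite -sumEFin.
by apply: integrable_sum => // x _; exact/integrable_Zindic/mAh.
Qed.

(** Independence of [A] from each fibre of [h] is enough, because [f] is a finite combination of the
    fibre indicators. *)
Lemma Rintegral_indicM (A : set T) (f : T -> R) : measurable A ->
  (forall x, P (A `&` [set w | h w = x]) = P A * P [set w | h w = x])%E ->
  factors h f -> \int[P]_w (\1_A w * f w) = fine (P A) * \int[P]_w f w.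
Proof.
move=> mA indA /factors_sum[g ->]; rewrite indicM_sum.
rewrite !Rintegral_sum//;
  try by move=> x; apply: integrable_Zindic => //; exact: mAh.
rewrite mulr_sumr; apply: eq_bigr => x _.
rewrite !RintegralZl ?Rintegral_indic//;
  try (by apply: integrable_indic => //; exact: mAh); last exact: mAh.
by rewrite indA fineM ?fin_num_measure// mulrCA.
Qed.

End finite_valued.

(** * Second moments and stopping for martingales adapted to a finite-valued history *)

Section square_integrable_martingale.
Context {dsp : measure_display} {T : measurableType dsp} {R : realType}.
Variable P : probability T R.
Variables (F : nat -> finType) (H : forall n, T -> F n).
Hypothesis mH : forall n x, measurable [set w | H n w = x].
Hypothesis filtH : forall n, factors (H n.+1) (H n).
Variable M : nat -> T -> R.
Hypothesis adaptM : forall n, factors (H n) (M n).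
(** Weak form of E[M_(n+1) - M_n | H_n] = 0: the increment is orthogonal to every function of the
    history. *)
Hypothesis martM : forall n (f : T -> R), factors (H n) f ->
  \int[P]_w ((M n.+1 w - M n w) * f w) = 0.

Let integrableH n (f : T -> R) : factors (H n) f ->
  P.-integrable setT (EFin \o f).
Proof. exact: integrable_factors. Qed.

Let factors_le m n (U : Type) (f : T -> U) : (m <= n)%N ->
  factors (H m) f -> factors (H n) f.
Proof.
move=> /subnK <-; elim: (n - m)%N => [//|k ih] mf w w' e.
by apply: ih => //; exact: filtH e.
Qed.

(** Pythagoras: the cross term 2 g Y (M_(n+1) - M_n) integrates to 0 since 2 g Y depends on the
    history only. The factor g covers plain increments (g = 1) as well as stopped ones. *)
Lemma martingale_transform_second_moment n (Y g : T -> R) :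
  factors (H n) Y -> factors (H n) g ->
  \int[P]_w (Y w + g w * (M n.+1 w - M n w)) ^+ 2 =
  \int[P]_w (Y w ^+ 2) + \int[P]_w (g w * (M n.+1 w - M n w)) ^+ 2.
Proof.
move=> aY ag.
have aY' := factors_le (leqnSn n) aY; have ag' := factors_le (leqnSn n) ag.
have aM' := factors_le (leqnSn n) (@adaptM n).
rewrite -[RHS]addr0 -(@martM n (fun w => 2 * (g w * Y w))); last first.
  by move=> w w' e; rewrite (aY _ _ e) (ag _ _ e).
rewrite -!RintegralD//; try (apply: (@integrableH n.+1 _) => w w' e;
  by rewrite (aY' _ _ e) ?(ag' _ _ e) ?(aM' _ _ e) ?(adaptM e)).
- by apply: eq_Rintegral => w _; ring.
- by apply: (@integrableH n.+1 _) => w w' e;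
    rewrite (ag' _ _ e) (aM' _ _ e) (adaptM e).
Qed.

(** A general [Y] serves three times: 0 for second moments, an earlier M_m for differences, a
    constant for non-degeneracy. *)
Lemma martingale_distance_momentS n (Y : T -> R) : factors (H n) Y ->
  \int[P]_w (M n.+1 w - Y w) ^+ 2 =
  \int[P]_w (M n w - Y w) ^+ 2 + \int[P]_w (M n.+1 w - M n w) ^+ 2.
Proof.
move=> aY.
have := @martingale_transform_second_moment n (fun w => M n w - Y w) (cst 1).
have -> : (fun w => (M n.+1 w - M n w) ^+ 2) =
    (fun w => (cst 1 w * (M n.+1 w - M n w)) ^+ 2).
  by apply/funext => w; rewrite /= mul1r.
move=> <-//.
  by congr Rintegral; apply/funext => w /=; congr (_ ^+ 2); ring.
by move=> w w' e; rewrite (adaptM e) (aY _ _ e).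
Qed.

Let V n := \int[P]_w (M n w) ^+ 2.

Lemma martingale_second_momentS n :
  V n.+1 = V n + \int[P]_w (M n.+1 w - M n w) ^+ 2.
Proof.
have sub0 k : (fun w => (M k w - cst 0 w) ^+ 2) = (fun w => M k w ^+ 2).
  by apply/funext => w; rewrite subr0.
by have := @martingale_distance_momentS n (cst 0) (fun _ _ _ => erefl);
  rewrite !sub0.
Qed.

Lemma martingale_second_momentB m n : (m <= n)%N ->
  \int[P]_w (M n w - M m w) ^+ 2 = V n - V m.
Proof.
move=> /subnK <-; elim: (n - m)%N => [|k ih].
  rewrite add0n subrr -[RHS](mul0r (fine (P setT))) -Rintegral_cst//.
  by apply: eq_Rintegral => w _; rewrite subrr expr0n.
rewrite addSn martingale_distance_momentS.
  by rewrite ih martingale_second_momentS addrAC.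
exact: factors_le (leq_addl _ _) (@adaptM m).
Qed.

Lemma le_martingale_centered_moment n c :
  \int[P]_w (M 0%N w - c) ^+ 2 <= \int[P]_w (M n w - c) ^+ 2.
Proof.
elim: n => // n ih.
rewrite (@martingale_distance_momentS n (cst c))// (le_trans ih)// lerDl.
by apply: Rintegral_ge0 => w _; rewrite sqr_ge0.
Qed.

(* The increments of M after time m, frozen at the first time that the sum
   leaves ]-lam, lam[. *)
Fixpoint stopped_increment (lam : R) (m j : nat) (w : T) : R :=
  if j is k.+1 then
    stopped_increment lam m k w +
    (`|stopped_increment lam m k w| < lam)%R%:R *
      (M (k + m).+1 w - M (k + m)%N w)
  else 0.

Lemma factors_stopped lam m j : factors (H (j + m)) (stopped_increment lam m j).
Proof.
elim: j => [//|j ih] w w' e /=.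
by rewrite (factors_le (leqnSn _) ih e)
  (factors_le (leqnSn _) (@adaptM _) e) (adaptM e).
Qed.

(** Once outside ]-lam, lam[ the stopped sum never moves again, so a value inside means that nothing
    has been frozen yet and the sum telescopes. *)
Lemma stopped_incrementE lam m j w : `|stopped_increment lam m j w| < lam ->
  stopped_increment lam m j w = M (j + m)%N w - M m w.
Proof.
elim: j => [|j ih] /=; first by rewrite add0n subrr.
case: (ltP `|stopped_increment lam m j w| lam) => [/ih -> _|ge].
  by rewrite mul1r addSn; ring.
by rewrite mul0r addr0 ltNge ge.
Qed.

(** Each increment is multiplied by a 0-1 function of the past, which can only lower its second
    moment. *)
Lemma stopped_increment_moment lam m j :
  \int[P]_w (stopped_increment lam m j w) ^+ 2 <= V (j + m) - V m.
Proof.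
elim: j => [|j ih] /=.
  rewrite add0n subrr -[leRHS](mul0r (fine (P setT))) -Rintegral_cst//.
  by under eq_Rintegral do rewrite expr0n.
have aS := @factors_stopped lam m j.
have aM := factors_le (leqnSn _) (@adaptM (j + m)%N).
rewrite martingale_transform_second_moment//; last first.
  by move=> w w' e; rewrite (aS _ _ e).
rewrite martingale_second_momentS addrAC lerD//; apply: le_Rintegral => //.
- apply: (@integrableH (j + m).+1 _) => w w' e.
  by rewrite (factors_le (leqnSn _) aS e) (aM _ _ e) (adaptM e).
- apply: (@integrableH (j + m).+1 _) => w w' e.
  by rewrite (aM _ _ e) (adaptM e).
- move=> w _; rewrite exprMn -natrX.
  by case: (_ < _); rewrite ?mul1r// mul0r sqr_ge0.
Qed.

Let exit lam m j := [set w | lam <= `|stopped_increment lam m j w|].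

Let measurable_exit lam m j : measurable (exit lam m j).
Proof.
have mS : measurable_fun setT (fun w => `|stopped_increment lam m j w|).
  apply: measurableT_comp => //.
  by have /integrableP[/measurable_EFinP] :=
    integrableH (@factors_stopped lam m j).
have := mS measurableT `[lam, +oo[%classic (measurable_itv _).
rewrite setTI; congr measurable; apply/seteqP.
by split => w; rewrite /exit /= in_itv/= andbT.
Qed.

(** Chebyshev's inequality for the stopped sum. *)
Lemma stopped_increment_prob lam m j : 0 < lam ->
  (P (exit lam m j) <=
    ((V (j + m) - V m) / lam ^+ 2)%:E)%E.
Proof.
move=> lam0; have aS := @factors_stopped lam m j.
set A := exit lam m j; have mA : measurable A by exact: measurable_exit.
rewrite -(fineK (fin_num_measure _ _ mA)) lee_fin ler_pdivlMr ?exprn_gt0//.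
apply: le_trans (stopped_increment_moment lam m j).
rewrite -(Rintegral_indic P) // -RintegralZr//; last exact: integrable_indic.
have aA : factors (H (j + m)) (fun w => \1_A w * lam ^+ 2).
  move=> w w' e; congr (_ * _); rewrite !indicE; congr (_%:R); congr nat_of_bool.
  by rewrite /A /exit; apply/idP/idP; rewrite !inE /= (aS _ _ e).
apply: le_Rintegral => //.
- exact: integrableH aA.
- by apply: (@integrableH (j + m)%N _) => w w' e; rewrite (aS _ _ e).
- move=> w _; rewrite indicE; have [|] := boolP (w \in A).
    rewrite inE /A /exit /= => le; rewrite mul1r -[leRHS]real_normK ?num_real//.
    by rewrite ler_pXn2r// ?nnegrE ltW.
  by rewrite mul0r sqr_ge0.
Qed.

(** * Almost sure and mean-square convergence of an L^2-bounded martingale *)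

Hypothesis bndM : has_ubound (range V).

Let v := sup (range V).

Let ndV : nondecreasing_seq V.
Proof.
apply/nondecreasing_seqP => n; rewrite martingale_second_momentS lerDl.
by apply: Rintegral_ge0 => w _; rewrite sqr_ge0.
Qed.

Let cvgV : V @ \oo --> v.
Proof. exact: nondecreasing_cvgn. Qed.

Let leV n : V n <= v.
Proof. by apply: ub_le_sup => //; exists n. Qed.

Let measurableM n : measurable_fun setT (M n).
Proof. by have /integrableP[/measurable_EFinP] := integrableH (@adaptM n). Qed.

(** Freezing makes the exit events increase with j, so the Chebyshev bound, uniform in j, passes to
    their union. *)
Lemma martingale_maximal_inequality lam m : 0 < lam ->
  (P (\bigcup_j exit lam m j) <= ((v - V m) / lam ^+ 2)%:E)%E.
Proof.
move=> lam0.
have cP : P \o exit lam m @ \oo --> P (\bigcup_j exit lam m j).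
  apply: nondecreasing_cvg_mu => //; first exact: bigcup_measurable.
  apply/nondecreasing_seqP => j; apply/subsetPset => w; rewrite /exit /= => le.
  by rewrite ltNge le mul0r addr0.
rewrite -(cvg_lim _ cP)//; apply: lime_le; first exact: cvgP cP.
apply: nearW => j /=; apply: le_trans (stopped_increment_prob _ _ lam0) _.
by rewrite lee_fin ler_pM2r ?invr_gt0 ?exprn_gt0// lerD2r leV.
Qed.

Lemma martingale_ae_cvg : {ae P, forall w, cvgn (M ^~ w)}.
Proof.
pose lam k : R := k.+1%:R^-1.
have lam0 k : 0 < lam k by rewrite invr_gt0.
have : {ae P, forall w, forall k, exists m, ~ (\bigcup_j exit (lam k) m j) w}.
  apply: ae_foralln => k.
  (* The null set: paths that, after every starting time m, move away by at least [lam k]. Its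
     probability is at most (v - V m) / lam_k^2 for all m, and V m tends to v. *)
  exists (\bigcap_m \bigcup_j exit (lam k) m j); split.
  - by apply: bigcapT_measurable => m; exact: bigcup_measurable.
  - apply/eqP; rewrite eq_le measure_ge0 andbT.
    have cv : (((v - V m) / lam k ^+ 2)%:E @[m --> \oo] --> 0%:E)%E.
      apply: cvg_EFin; first exact: nearW.
      rewrite -[X in _ --> X](mul0r (lam k ^+ 2)^-1).
      apply: cvgM; last exact: cvg_cst.
      by rewrite -[X in _ --> X](subrr v); apply: cvgB => //; exact: cvg_cst.
    rewrite -[leRHS](cvg_lim _ cv)//; apply: lime_ge; first exact: cvgP cv.
    apply: nearW => m; apply: le_trans (martingale_maximal_inequality _ (lam0 k)).
    apply: le_measure; rewrite ?inE.
    + by apply: bigcapT_measurable => i; exact: bigcup_measurable.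
    + exact: bigcup_measurable.
    + by apply: bigcap_inf.
  - move=> w /= nex m _; apply: contrapT => nb; apply: nex; exists m.
    exact: nb.
apply: filterS => w hw; apply/cauchy_cvgP; apply: cauchy_exP => e e0.
have [k ke] : exists k, lam k < e.
  near \oo => k; exists k; near: k.
  by apply: (cvgr_lt 0) => //; exact: cvg_harmonic.
have [m nm] := hw k.
(* After time m the stopped sum stays below [lam k] in absolute value, hence equals [M n w - M m w];
   the path remains in the ball around [M m w]. *)
exists (M m w); exists m => // n /= /subnK <-.
rewrite /ball /= distrC.
have lt j : `|stopped_increment (lam k) m j w| < lam k.
  by rewrite ltNge; apply/negP => le; apply: nm; exists j.
by rewrite -(stopped_incrementE (lt _)) (lt_trans (lt _)).
Unshelve. all: by end_near. Qed.

(** The upper limit exists at every point, so measurability does not depend on convergence; [fine]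
    sends an infinite value to 0. *)
Definition martingale_limit (w : T) : R :=
  fine (limn_esup (fun n => (M n w)%:E)).

Lemma measurable_martingale_limit : measurable_fun setT martingale_limit.
Proof.
apply: measurableT_comp => //; apply: measurable_fun_limn_esup => n.
exact/measurable_EFinP.
Qed.

Lemma martingale_limit_ae_cvg :
  {ae P, forall w, M ^~ w @ \oo --> martingale_limit w}.
Proof.
apply: filterS martingale_ae_cvg => w /cvg_ex[l ul].
suff -> : martingale_limit w = l by [].
have ul' : (M n w)%:E @[n --> \oo] --> l%:E.
  by apply: cvg_EFin => //; exact: nearW.
by rewrite /martingale_limit (cvg_limn_einf_sup ul').2.
Qed.

(** Fatou's lemma in N for (M_N - M_n)^2, whose integral is V N - V n once N >= n. *)
Lemma martingale_limit_second_moment n :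
  (\int[P]_w ((M n w - martingale_limit w) ^+ 2)%:E <= (v - V n)%:E)%E.
Proof.
pose f N w : \bar R := ((M N w - M n w) ^+ 2)%:E.
have mf N : measurable_fun setT (f N).
  apply/measurable_EFinP; apply: measurable_funX; exact: measurable_funB.
have -> : (\int[P]_w ((M n w - martingale_limit w) ^+ 2)%:E =
    \int[P]_w limn_einf (f ^~ w))%E.
  apply: ae_eq_integral => //.
  - apply/measurable_EFinP; apply: measurable_funX; apply: measurable_funB => //.
    exact: measurable_martingale_limit.
  - rewrite (_ : (fun w => _) = (fun w => - limn_esup (fun N => - f N w))%E)//.
    apply: measurableT_comp => //; apply: measurable_fun_limn_esup => N.
    exact: measurableT_comp.
  - apply: filterS martingale_limit_ae_cvg => w cw _.
    have cf : f ^~ w @ \oo --> ((M n w - martingale_limit w) ^+ 2)%:E.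
      apply: cvg_EFin; first exact: nearW.
      have cd : M N w - M n w @[N --> \oo] --> martingale_limit w - M n w.
        by apply: cvgB => //; exact: cvg_cst.
      by rewrite -sqrrN opprB; apply: cvgM.
    by rewrite (cvg_limn_einf_sup cf).1.
apply: le_trans (fatou _ _ mf _) _ => //.
  by move=> N w _; rewrite lee_fin sqr_ge0.
have ci : (\int[P]_w f N w)%E @[N --> \oo] --> (v - V n)%:E.
  have : (V N - V n)%:E @[N --> \oo] --> (v - V n)%:E.
    apply: cvg_EFin; first exact: nearW.
    by apply: cvgB => //; exact: cvg_cst.
  apply: cvg_trans; apply: near_eq_cvg; near=> N.
  have nN : (n <= N)%N by near: N; exact: nbhs_infty_ge.
  rewrite -martingale_second_momentB// /Rintegral fineK//.
  apply: (@integrable_fin_num _ _ _ _ _ _ (f N)) => //.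
  apply: (@integrableH N) => w w' e.
  by rewrite (adaptM e) (factors_le nN (@adaptM n) e).
by rewrite (cvg_limn_einf_sup ci).1.
Unshelve. all: by end_near. Qed.

Lemma martingale_L2_cvg :
  (\int[P]_w ((M n w - martingale_limit w) ^+ 2)%:E)%E @[n --> \oo] --> 0%E.
Proof.
have c : (v - V n)%:E @[n --> \oo] --> 0%E.
  apply: cvg_EFin; first exact: nearW.
  by rewrite -[X in _ --> X](subrr v); apply: cvgB => //; exact: cvg_cst.
apply: (squeeze_cvge _ (cvg_cst 0%E) c).
apply: nearW => n; rewrite martingale_limit_second_moment andbT.
by apply: integral_ge0 => w _; rewrite lee_fin sqr_ge0.
Qed.

Let square_integrable_limit :
  exists2 K : R, 0 <= K & (\int[P]_w (martingale_limit w ^+ 2)%:E <= K%:E)%E.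
Proof.
have mL := measurable_martingale_limit.
(* From L^2 <= 2 M_0^2 + 2 (M_0 - L)^2; the difference of the two sides is (2 M_0 - L)^2. *)
exists (2 * V 0%N + 2 * (v - V 0%N)).
  rewrite addr_ge0// mulr_ge0// ?subr_ge0//.
  by apply: Rintegral_ge0 => w _; rewrite sqr_ge0.
have m0 : measurable_fun setT (fun w => (M 0%N w ^+ 2)%:E).
  by apply/measurable_EFinP; exact: measurable_funX.
have m1 : measurable_fun setT (fun w => ((M 0%N w - martingale_limit w) ^+ 2)%:E).
  by apply/measurable_EFinP; apply: measurable_funX; exact: measurable_funB.
apply: (@le_trans _ _ (\int[P]_w (2%:E * (M 0%N w ^+ 2)%:E +
    2%:E * ((M 0%N w - martingale_limit w) ^+ 2)%:E))%E).
  apply: ge0_le_integral => //.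
  - by move=> w _; rewrite lee_fin sqr_ge0.
  - by apply/measurable_EFinP; exact: measurable_funX.
  - by apply: emeasurable_funD; apply: emeasurable_funM.
  - by move=> w _; rewrite -!EFinM -EFinD lee_fin;
      have := sqr_ge0 (2 * M 0%N w - martingale_limit w); nra.
rewrite ge0_integralD//;
  try (by move=> w _; rewrite -EFinM lee_fin mulr_ge0// sqr_ge0);
  try exact: emeasurable_funM.
rewrite !ge0_integralZl//; try (by move=> w _; rewrite lee_fin sqr_ge0).
rewrite [leRHS]EFinD !EFinM; apply: leeD; rewrite lee_pmul2l//.
  rewrite /V /Rintegral fineK//.
  apply: (@integrable_fin_num _ _ _ _ _ _ (EFin \o (fun w => M 0%N w ^+ 2))) => //.
  by apply: (@integrableH 0%N) => w w' e; rewrite (adaptM e).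
exact: martingale_limit_second_moment.
Qed.

(** Transfers mean-square convergence to the normalization by n^a. It rests on c_n M_n - k L = c_n
    (M_n - L) + (c_n - k) L and (x + y)^2 <= 2 x^2 + 2 y^2. *)
Lemma martingale_scaled_L2_cvg (c : nat -> R) (k : R) : c @ \oo --> k ->
  (\int[P]_w ((c n * M n w - k * martingale_limit w) ^+ 2)%:E)%E
    @[n --> \oo] --> 0%E.
Proof.
move=> ck; have [K K0 LK] := square_integrable_limit.
have mL := measurable_martingale_limit.
pose r n := 2 * c n ^+ 2 * (v - V n) + 2 * (c n - k) ^+ 2 * K.
have r0 : (r n)%:E @[n --> \oo] --> 0%E.
  apply: cvg_EFin; first exact: nearW.
  rewrite -[X in _ --> X](_ :
      2 * (k * k) * (v - v) + 2 * ((k - k) * (k - k)) * K = 0);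
    last by rewrite !subrr !(mulr0, mul0r) addr0.
  have cB : c n - k @[n --> \oo] --> k - k by apply: cvgB => //; exact: cvg_cst.
  apply: cvgD.
    apply: cvgM; last by apply: cvgB => //; exact: cvg_cst.
    by apply: cvgM; [exact: cvg_cst|exact: cvgM].
  apply: cvgM; last exact: cvg_cst.
  by apply: cvgM; [exact: cvg_cst|exact: cvgM].
apply: (squeeze_cvge _ (cvg_cst 0%E) r0); apply: nearW => n.
rewrite integral_ge0/=; last by move=> w _; rewrite lee_fin sqr_ge0.
have m1 : measurable_fun setT (fun w => ((M n w - martingale_limit w) ^+ 2)%:E).
  by apply/measurable_EFinP; apply: measurable_funX; exact: measurable_funB.
have m2 : measurable_fun setT (fun w => (martingale_limit w ^+ 2)%:E).
  by apply/measurable_EFinP; exact: measurable_funX.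
apply: (@le_trans _ _ (\int[P]_w
    ((2 * c n ^+ 2)%:E * ((M n w - martingale_limit w) ^+ 2)%:E +
     (2 * (c n - k) ^+ 2)%:E * (martingale_limit w ^+ 2)%:E))%E).
  apply: ge0_le_integral => //.
  - by move=> w _; rewrite lee_fin sqr_ge0.
  - apply/measurable_EFinP; apply: measurable_funX.
    by apply: measurable_funB; exact: measurable_funM.
  - by apply: emeasurable_funD; apply: emeasurable_funM.
  - move=> w _; rewrite -!EFinM -EFinD lee_fin.
    set x := c n * (M n w - martingale_limit w).
    set y := (c n - k) * martingale_limit w.
    have -> : c n * M n w - k * martingale_limit w = x + y by rewrite /x /y; ring.
    rewrite [leRHS](_ : _ = 2 * x ^+ 2 + 2 * y ^+ 2); last by rewrite /x /y; ring.
    by have := sqr_ge0 (x - y); nra.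
have cge (t : R) : 0 <= 2 * t ^+ 2 by rewrite mulr_ge0// sqr_ge0.
rewrite ge0_integralD//;
  try (by move=> w _; rewrite -EFinM lee_fin mulr_ge0// sqr_ge0);
  try exact: emeasurable_funM.
rewrite !ge0_integralZl//; try (by move=> w _; rewrite lee_fin sqr_ge0);
  try (by rewrite lee_fin).
rewrite /r [leRHS]EFinD !(EFinM (2 * _)); apply: leeD;
  rewrite lee_wpmul2l ?lee_fin//.
exact: martingale_limit_second_moment.
Qed.

(** If the limit is c almost surely, E (M_n - c)^2 tends to 0, yet it is never below E (M_0 -
    c)^2. *)
Lemma martingale_limit_cst (c : R) : P [set w | martingale_limit w = c] = 1%E ->
  \int[P]_w (M 0%N w - c) ^+ 2 = 0.
Proof.
move=> Pc; apply/eqP; rewrite eq_le Rintegral_ge0 ?andbT; last first.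
  by move=> w _; rewrite sqr_ge0.
have mc : measurable [set w | martingale_limit w = c].
  have := measurable_martingale_limit measurableT (measurable_set1 c).
  by rewrite setTI.
have ae : {ae P, forall w, martingale_limit w = c}.
  exists (~` [set w | martingale_limit w = c]); split => //.
    exact: measurableC.
  by rewrite probability_setC// Pc subee.
rewrite -lee_fin -[leRHS](cvg_lim _ martingale_L2_cvg)//.
apply: lime_ge; first exact: cvgP martingale_L2_cvg.
apply: nearW => n.
rewrite (@ae_eq_integral _ _ _ P setT (fun w => ((M n w - c) ^+ 2)%:E))//.
- apply: (@le_trans _ _ (\int[P]_w (M n w - c) ^+ 2)%:E).
    by rewrite lee_fin; exact: le_martingale_centered_moment.
  rewrite /Rintegral fineK//.
  apply: (@integrable_fin_num _ _ _ _ _ _ (EFin \o (fun w => (M n w - c) ^+ 2))) => //.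
  by apply: (@integrableH n) => w w' e; rewrite (adaptM e).
- apply/measurable_EFinP; apply: measurable_funX; apply: measurable_funB => //.
  exact: measurable_martingale_limit.
- apply/measurable_EFinP; apply: measurable_funX; apply: measurable_funB => //.
- by apply: filterS ae => w -> _.
Qed.

End square_integrable_martingale.

(** * Asymptotics of the normalizing products *)

Section growth.
Context {R : realType}.
Implicit Types a x : R.

(* In the notation above, growth a n = gamma_(n+1). *)
Definition growth a n : R := \prod_(k < n) (1 + a / k.+1%:R).

Lemma growth0 a : growth a 0 = 1.
Proof. by rewrite /growth big_ord0. Qed.

Lemma growthS a n : growth a n.+1 = growth a n * (1 + a / n.+1%:R).
Proof. by rewrite /growth big_ord_recr. Qed.

Lemma growth_gt0 a n : 0 <= a -> 0 < growth a n.
Proof.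
by move=> a0; apply: prodr_gt0 => k _; rewrite ltr_wpDr// divr_ge0.
Qed.

(* With u_n = (n + 1) / growth n ^ 2 one has
   u_n - u_(n+1) = (2a - 1 + a^2 / (n + 1)) / growth (n + 1) ^ 2. *)
Lemma sum_growth_sqrV a n : 1 / 2 < a ->
  \sum_(k < n) (growth a k.+1 ^+ 2)^-1 <= (2 * a - 1)^-1.
Proof.
move=> a2; have a0 : 0 <= a by lra.
have b0 : 0 < 2 * a - 1 by lra.
suff : \sum_(k < n) (growth a k.+1 ^+ 2)^-1 <=
    (1 - n.+1%:R / growth a n ^+ 2) / (2 * a - 1).
  move=> /le_trans; apply; rewrite ler_pdivrMr// mulVf ?gt_eqF//.
  by rewrite gerBl divr_ge0// sqr_ge0.
elim: n => [|n ih]; first by rewrite big_ord0 growth0 expr1n divr1 subrr mul0r.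
rewrite big_ord_recr/= (le_trans (lerD ih (lexx _)))//.
rewrite -lerBrDl -mulrBl ler_pdivlMr//.
have g0 := growth_gt0 n a0; have g1 := growth_gt0 n.+1 a0.
have n0 : 0 < n.+1%:R :> R by [].
have -> : 1 - n.+2%:R / growth a n.+1 ^+ 2 - (1 - n.+1%:R / growth a n ^+ 2) =
    (growth a n.+1 ^+ 2)^-1 * (2 * a - 1 + a ^+ 2 / n.+1%:R).
  rewrite growthS -[n.+2%:R]natr1; set m := n.+1%:R in n0 *.
  by field; rewrite !gt_eqF //; lra.
by rewrite ler_wpM2l ?invr_ge0 ?sqr_ge0// lerDl divr_ge0// sqr_ge0.
Qed.

(** Bernoulli's inequality, by concavity of [ln] between 1 and 1 + x: its tangent at z = a (1 + x) +
    (1 - a) lies above it at both points. *)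
Lemma powR_1D_le a x : 0 <= a <= 1 -> 0 <= x -> (1 + x) `^ a <= 1 + a * x.
Proof.
move=> /andP[a0 a1] x0; have y0 : 0 < 1 + x by lra.
have z0 : 0 < 1 + a * x by rewrite ltr_wpDr// mulr_ge0.
rewrite -ler_ln ?posrE ?powR_gt0// ln_powR.
set y := 1 + x; set z := 1 + a * x.
have le_lnB (t : R) : 0 < t -> ln t - ln z <= t / z - 1.
  move=> t0; rewrite -ln_div ?posrE// -[X in ln X](subrKC 1).
  by rewrite le_ln1Dx// ltrBDr addrC subrr divr_gt0.
have h1 := le_lnB _ y0; have h2 := le_lnB _ ltr01.
have h3 : a * (ln y - ln z) + (1 - a) * (ln 1 - ln z) <=
    a * (y / z - 1) + (1 - a) * (1 / z - 1).
  by rewrite lerD// ler_wpM2l// subr_ge0.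
have h4 : a * (y / z - 1) + (1 - a) * (1 / z - 1) = 0.
  by rewrite /y /z; field; rewrite gt_eqF.
rewrite h4 ln1 in h3; nra.
Qed.

(** Taking inverses, this is exp(-t) >= 1 - t at t = 1 / (n + 2). *)
Lemma expR_le_1DV n : expR (n.+2%:R^-1) <= 1 + n.+1%:R^-1 :> R.
Proof.
have n0 : 0 < n.+1%:R :> R by [].
suff : (1 + n.+1%:R^-1)^-1 <= (expR (n.+2%:R^-1))^-1 :> R.
  by rewrite lef_pV2 ?posrE ?expR_gt0// ltr_wpDr.
rewrite -expRN; apply: le_trans (expR_ge1Dx _); rewrite -[n.+2%:R]natr1.
set m := n.+1%:R in n0 *; rewrite le_eqVlt; apply/orP; left; apply/eqP.
by field; rewrite !gt_eqF //; lra.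
Qed.

(** The quotient starts at 1 and increases by Bernoulli's inequality. Each ratio is at most exp(a /
    (n + 1) - a / (n + 2)), and these bounds telescope to at most exp(a). *)
Lemma growth_powR_cvg a : 0 <= a <= 1 ->
  exists2 kappa : R, 0 < kappa &
    growth a n / n.+1%:R `^ a @[n --> \oo] --> kappa.
Proof.
move=> /andP[a0 a1]; pose c n := growth a n / n.+1%:R `^ a.
have c0 : c 0%N = 1 by rewrite /c growth0 powR1 divr1.
have cgt0 n : 0 < c n by rewrite divr_gt0 ?growth_gt0 ?powR_gt0.
have cS n : c n.+1 = c n * ((1 + a / n.+1%:R) / (1 + n.+1%:R^-1) `^ a).
  rewrite /c growthS.
  have -> : n.+2%:R `^ a = n.+1%:R `^ a * (1 + n.+1%:R^-1) `^ a :> R.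
    rewrite -powRM// ?addr_ge0//.
    by rewrite mulrDr mulr1 divff ?pnatr_eq0// natr1.
  field.
  by rewrite !gt_eqF ?powR_gt0// ltr_wpDr.
have ndc : nondecreasing_seq c.
  apply/nondecreasing_seqP => n; rewrite cS ler_peMr ?(ltW (cgt0 n))//.
  rewrite ler_pdivlMr ?powR_gt0// ?ltr_wpDr// mul1r.
  by apply: powR_1D_le; rewrite ?a0.
have cub n : c n <= expR (a * (1 - n.+1%:R^-1)).
  elim: n => [|n ih]; first by rewrite c0 invr1 subrr mulr0 expR0.
  rewrite cS (_ : _ * (1 - n.+2%:R^-1) =
    a * (1 - n.+1%:R^-1) + a * (n.+1%:R^-1 - n.+2%:R^-1)); last by ring.
  rewrite expRD ler_pM ?(ltW (cgt0 n))//.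
    by rewrite divr_ge0 ?powR_ge0// addr_ge0// divr_ge0.
  rewrite mulrBr expRD expRN ler_pM ?invr_ge0 ?powR_ge0//.
  - by rewrite addr_ge0// divr_ge0.
  - exact: expR_ge1Dx.
  - rewrite lef_pV2 ?posrE ?expR_gt0 ?powR_gt0 ?ltr_wpDr//.
    rewrite mulrC expRM ge0_ler_powR ?nnegrE ?expR_ge0 ?addr_ge0//.
    exact: expR_le_1DV.
exists (sup (range c)).
  apply: lt_le_trans (cgt0 0%N) _; apply: ub_le_sup; last by exists 0%N.
  exists (expR a) => _ [n _ <-]; rewrite (le_trans (cub n))// ler_expR.
  by rewrite ler_piMr// gerBl.
apply: nondecreasing_cvgn => //.
exists (expR a) => _ [n _ <-]; rewrite (le_trans (cub n))// ler_expR.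
by rewrite ler_piMr// gerBl.
Qed.
End growth.

(** * Algebra of the steps and of the powers of J *)

Section step_matrices.
Context {R : realType} {d : nat}.
Implicit Types (u v : 'I_d * bool) (x : 'cV[R]_d).

(** One finite type, an index with a sign bit, codes both the 2d possible steps and, in [step_mx],
    the 2d possible matrices. *)
Definition signed_basis u : 'cV[R]_d := (-1) ^+ u.2 *: ebasis R u.1.

Definition step_mx u : 'M[R]_d := (-1) ^+ u.2 *: Jmat R d ^+ u.1.

Lemma Jmat_expE k i j : (Jmat R d ^+ k) i j = (j == iter k (@ordS d) i)%:R.
Proof.
elim: k j => [|k ih] j; first by rewrite expr0 mxE eq_sym.
rewrite exprSr -mulmxE mxE (bigD1 (iter k (@ordS d) i))//= big1 ?addr0.
  by rewrite ih eqxx mul1r mxE.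
by move=> l /negbTE ne; rewrite ih ne mul0r.
Qed.

(** Column i of J has its only 1 in the cyclically preceding row. *)
Lemma mul_Jmat_ebasis i :
  Jmat R d *m ebasis R i = ebasis R (ord_pred i).
Proof.
apply/matrixP => j k; rewrite -colE !mxE ord1 eqxx andbT; congr (_%:R).
rewrite -[X in nat_of_bool X]/(val i == val (ordS j)) val_eqE.
by rewrite -[i in LHS]ord_predK (inj_eq (@ordS_inj d)) eq_sym.
Qed.

Lemma mul_Jmat_exp_ebasis k i :
  Jmat R d ^+ k *m ebasis R i = ebasis R (iter k (@ord_pred d) i).
Proof.
elim: k => [|k ih]; first by rewrite expr0 mul1mx.
by rewrite exprS -mulmxE -mulmxA ih mul_Jmat_ebasis.
Qed.

Lemma step_mx_signed_basis u v :
  exists v', step_mx u *m signed_basis v = signed_basis v'.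
Proof.
exists (iter u.1 (@ord_pred d) v.1, u.2 (+) v.2).
rewrite /step_mx /signed_basis -scalemxAl -scalemxAr scalerA.
by rewrite mul_Jmat_exp_ebasis signr_addb.
Qed.

Lemma val_iter_ordS k (i : 'I_d) : (i + k < d)%N ->
  iter k (@ordS d) i = (i + k)%N :> nat.
Proof.
elim: k => [|k ih] lt /=; first by rewrite addn0.
by rewrite ih ?modn_small -?addnS// (leq_trans _ lt)// addnS.
Qed.

(** For k < d the first row of J^k has its only 1 in column k, so that row reveals both the exponent
    and the sign. *)
Lemma step_mx_inj : injective step_mx.
Proof.
move=> [k s] [l t]; have d0 : (0 < d)%N by case: (d) k => [[]|].
pose o := Ordinal d0.
move=> /matrixP e; have := e o k; have := e o l.
have val0 (i : 'I_d) : iter i (@ordS d) o = i.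
  by apply: val_inj; rewrite [LHS]val_iter_ordS /= add0n.
rewrite /step_mx !mxE !Jmat_expE !val0 !eqxx /=.
have [<-|ne] := eqVneq k l.
  by rewrite !mulr1 => /(@signr_inj R) ->.
by rewrite mulr0 mulr1 => /eqP; rewrite eq_sym signr_eq0.
Qed.

Lemma A_valuesP (M : 'M[R]_d) : (0 < d)%N -> M \in A_values R d ->
  exists u, M = step_mx u.
Proof.
rewrite inE => d0 [->|[->|[k [/andP[_ kd] [->|->]]]]].
- by exists (Ordinal d0, false); rewrite /step_mx scale1r.
- by exists (Ordinal d0, true); rewrite /step_mx scaleN1r.
- by exists (Ordinal kd, false); rewrite /step_mx scale1r.
- by exists (Ordinal kd, true); rewrite /step_mx scaleN1r.
Qed.

Lemma pm_basisP x : pm_basis R d x <-> exists u, x = signed_basis u.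
Proof.
split=> [[i [->|->]]|[[i [|]] ->]].
- by exists (i, false); rewrite /signed_basis scale1r.
- by exists (i, true); rewrite /signed_basis scaleN1r.
- by exists i; right; rewrite /signed_basis scaleN1r.
- by exists i; left; rewrite /signed_basis scale1r.
Qed.

Lemma signed_basis_sqr_le1 u i : (signed_basis u i ord0) ^+ 2 <= 1.
Proof.
rewrite /signed_basis !mxE exprMn sqrr_sign mul1r -natrX -[leRHS]/(1%:R).
by rewrite ler_nat; case: (_ && _).
Qed.

(* The contributions of J^k and - J^k cancel for k > 0. *)
Lemma sum_step_mx (p q : R) (mu : 'I_d * bool -> R) : (0 < d)%N ->
  (forall u, mu u = if (u.1 == 0%N :> nat) && ~~ u.2 then p else q) ->
  \sum_u mu u *: step_mx u = (p - q)%:M.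
Proof.
move=> d0 muE; 
rewrite (eq_bigr (fun u => mu (u.1, u.2) *: step_mx (u.1, u.2))); last by case.
rewrite -(pair_bigA _ (fun k s => mu (k, s) *: step_mx (k, s)))/=.
under eq_bigr do rewrite big_bool.
rewrite (bigD1 (Ordinal d0))//= big1 ?addr0 => [|k k0].
  rewrite !muE /= /step_mx /= expr1 expr0 !scale1r scaleN1r.
  by rewrite scalerN addrC -scalerBl scalemx1.
have /negbTE kE : k != 0%N :> nat.
  by apply: contra k0 => /eqP e; apply/eqP/val_inj.
by rewrite !muE /= kE /step_mx /= scale1r scaleN1r scalerN addNr.
Qed.

End step_matrices.

(** * The walk and the finite coding of its history *)

Section elephant_random_walk.
Context {R : realType} {dsp : measure_display} {T : measurableType dsp}.
Variables (P : probability T R) (d : nat) (p : R).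
Variables (X : nat -> T -> 'cV[R]_d) (b : nat -> T -> nat).
Variable A : nat -> T -> 'M[R]_d.
Hypothesis d_gt0 : (0 < d)%N.
Hypothesis X1_pm : forall w, X 1%N w \in pm_basis R d.
Hypothesis mX1 : forall v, measurable [set w | X 1%N w = v].
Hypothesis b_range : forall n w, (0 < n)%N -> (1 <= b n w <= n)%N.
Hypothesis mb : forall n k, measurable [set w | b n w = k].
Hypothesis Pb : forall n k, (1 <= k <= n)%N ->
  P [set w | b n w = k] = (n%:R^-1)%:E.
Hypothesis A_range : forall n w, (0 < n)%N -> A n w \in A_values R d.
Hypothesis mA : forall n M, measurable [set w | A n w = M].
Let q := (1 - p) / (2 * d%:R - 1).
Hypothesis PA1 : forall n, (0 < n)%N -> P [set w | A n w = 1%:M] = p%:E.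
Hypothesis PAN1 : forall n, (0 < n)%N -> P [set w | A n w = - 1%:M] = q%:E.
Hypothesis PAJ : forall n k, (0 < n)%N -> (1 <= k < d)%N ->
  P [set w | A n w = Jmat R d ^+ k] = q%:E.
Hypothesis PANJ : forall n k, (0 < n)%N -> (1 <= k < d)%N ->
  P [set w | A n w = - Jmat R d ^+ k] = q%:E.
Hypothesis indep : forall n (K : set nat) (C : set 'M[R]_d)
    (B : set ('I_n -> 'cV[R]_d)), (0 < n)%N ->
  P ((b n) @^-1` K `&` (A n) @^-1` C `&` (hist X n) @^-1` B) =
  (P ((b n) @^-1` K) * P ((A n) @^-1` C) * P ((hist X n) @^-1` B))%E.
Hypothesis XS : forall n w, (0 < n)%N -> X n.+1 w = A n w *m X (b n w) w.

Let a := (2 * d%:R * p - 1) / (2 * d%:R - 1).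

Lemma step_pm k w : (0 < k)%N -> pm_basis R d (X k w).
Proof.
elim/ltn_ind: k => -[//|[_ _|n ih _]]; first exact/set_mem.
have [u Au] := A_valuesP d_gt0 (@A_range n.+1 w isT).
have /andP[b1 bn] := @b_range n.+1 w isT.
have /pm_basisP[v Xv] := (ih _ bn b1).
rewrite XS// Au Xv; apply/pm_basisP; exact: step_mx_signed_basis.
Qed.

Definition step_code (x : 'cV[R]_d) : 'I_d * bool :=
  xget (Ordinal d_gt0, false) [set u | x = signed_basis u].

Lemma step_codeK x : pm_basis R d x -> signed_basis (step_code x) = x.
Proof.
by move=> /pm_basisP[u xu]; rewrite /step_code; case: xgetP => // /(_ u).
Qed.

(** [history n] codes the n + 1 steps X_1, ..., X_(n+1), so it generates F_(n+1) and index 0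
    corresponds to the first step. *)
Definition history n w : {ffun 'I_n.+1 -> 'I_d * bool} :=
  [ffun i : 'I_n.+1 => step_code (X i.+1 w)].

Lemma factors_step n k : (k <= n)%N -> factors (history n) (X k.+1).
Proof.
move=> kn w w' /ffunP /(_ (Ordinal (kn : (k < n.+1)%N))).
rewrite !ffunE /= => e.
by rewrite -(step_codeK (@step_pm k.+1 w isT)) e step_codeK//; exact: step_pm.
Qed.

Lemma factors_history n : factors (history n.+1) (history n).
Proof.
move=> w w' e; apply/ffunP => i; rewrite !ffunE; congr step_code.
by apply: factors_step e; rewrite ltnW// ltnS ltnW.
Qed.

Lemma factors_position n : factors (history n) (Spos X n.+1).
Proof.
move=> w w' e; apply: eq_big_nat => -[//|k] /andP[_ kn].
exact: factors_step e.
Qed.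

(** Strong induction: fixing the values of [b] and [A] reduces the event to an earlier step. [B] is
    general because it gets replaced by its preimage under a matrix. *)
Lemma measurable_step k (B : set 'cV[R]_d) : (0 < k)%N ->
  measurable [set w | B (X k w)].
Proof.
elim/ltn_ind: k B => -[//|[_ B _|n ih B _]].
  have -> : [set w | B (X 1%N w)] =
      \bigcup_(u in [set u | B (signed_basis u)])
        [set w | X 1%N w = signed_basis u].
    apply/seteqP; split => [w /= Bw|w [u /= Bu ->]//].
    have /pm_basisP[u e] := (@step_pm 1 w isT).
    by exists u; rewrite //= -e.
  by apply: fin_bigcup_measurable.
have -> : [set w | B (X n.+2 w)] =
    \bigcup_(j in [set: 'I_n.+1 * ('I_d * bool)])
      ([set w | b n.+1 w = j.1.+1] `&` [set w | A n.+1 w = step_mx j.2] `&`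
       [set w | B (step_mx j.2 *m X j.1.+1 w)]).
  apply/seteqP; split => [w /= Bw|w [[k u] _ /= [[bk Au]]]]; last first.
    by rewrite (@XS n.+1)// Au bk.
  have [u Au] := A_valuesP d_gt0 (@A_range n.+1 w isT).
  have /andP[b1 bn] := @b_range n.+1 w isT.
  have kn : ((b n.+1 w).-1 < n.+1)%N by rewrite prednK.
  exists (Ordinal kn, u) => //=; rewrite prednK//; split; first by split.
  by rewrite -Au -XS.
apply: fin_bigcup_measurable => // -[k u] _ /=.
apply: measurableI; first exact: measurableI.
by apply: (ih _ _ [set x | B (step_mx u *m x)]) => //; rewrite ltnS.
Qed.

Lemma measurable_history n x : measurable [set w | history n w = x].
Proof.
have -> : [set w | history n w = x] =
    \bigcap_(i in [set: 'I_n.+1]) [set w | step_code (X i.+1 w) = x i].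
  apply/seteqP; split => [w /= <- i _|w /= h]; first by rewrite /= ffunE.
  by apply/ffunP => i; rewrite ffunE; exact: h.
apply: fin_bigcap_measurable => // i _.
exact: (@measurable_step i.+1 [set v | step_code v = x i]).
Qed.

(** * Conditional mean of the next step *)

Let mu (u : 'I_d * bool) := if (u.1 == 0%N :> nat) && ~~ u.2 then p else q.

Lemma prob_step_mx n u : (0 < n)%N ->
  P [set w | A n w = step_mx u] = (mu u)%:E.
Proof.
case: u => k s n0; rewrite /mu /step_mx /=.
have [k0|k0] := eqVneq (k : nat) 0%N.
  by rewrite k0 expr0; case: s; rewrite /= ?scaleN1r ?scale1r ?PA1 ?PAN1.
have kd : (1 <= k < d)%N by rewrite lt0n k0 /=.
by case: s; rewrite /= ?scaleN1r ?scale1r ?PAJ ?PANJ.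
Qed.

Let event n (j : 'I_n.+1 * ('I_d * bool)) :=
  [set w | b n.+1 w = j.1.+1] `&` [set w | A n.+1 w = step_mx j.2].

Let measurable_event n j : measurable (@event n j).
Proof. exact: measurableI. Qed.

Lemma prob_event n j : P (@event n j) = (n.+1%:R^-1 * mu j.2)%:E.
Proof.
have := @indep n.+1 [set j.1.+1] [set step_mx j.2] setT isT.
rewrite preimage_setT setIT probability_setT mule1.
rewrite -[b n.+1 @^-1` _]/[set w | b n.+1 w = j.1.+1].
rewrite -[A n.+1 @^-1` _]/[set w | A n.+1 w = step_mx j.2].
by move=> ->; rewrite Pb ?prob_step_mx// ltn_ord.
Qed.

Lemma event_indep n j x : (P (@event n j `&` [set w | history n w = x]) =
  P (@event n j) * P [set w | history n w = x])%E.
Proof.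
(* The history event is the preimage of [B] under [hist]. The second use of [indep], with [setT],
   merges the factors of [b] and [A] into the probability of [event]. *)
pose B := [set h : 'I_n.+1 -> 'cV[R]_d | [ffun i => step_code (h i)] = x].
have := @indep n.+1 [set j.1.+1] [set step_mx j.2] B isT.
have := @indep n.+1 [set j.1.+1] [set step_mx j.2] setT isT.
by rewrite preimage_setT setIT probability_setT mule1 => <-.
Qed.

(** Exactly one indicator is nonzero; that the events are disjoint uses injectivity of [step_mx]. *)
Lemma step_decomposition n w :
  X n.+2 w = \sum_j \1_(@event n j) w *: (step_mx j.2 *m X j.1.+1 w).
Proof.
have [u Au] := A_valuesP d_gt0 (@A_range n.+1 w isT).
have /andP[b1 bn] := @b_range n.+1 w isT.
have kn : ((b n.+1 w).-1 < n.+1)%N by rewrite prednK.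
rewrite (bigD1 (Ordinal kn, u))//= big1 ?addr0 => [|[k v] /= ne].
  by rewrite indicE mem_set ?scale1r ?prednK// -?Au ?XS//;
    split; rewrite //= prednK.
rewrite indicE memNset ?scale0r//= => -[/= bk Av]; move/eqP: ne; apply.
rewrite Au in Av; rewrite (step_mx_inj Av); congr pair.
by apply: val_inj; rewrite /= bk.
Qed.

(** Weak form of E[X_(n+2) | F_(n+1)] = (a / (n + 1)) S_(n+1): by independence each indicator is
    replaced by its probability, and summing over the matrices leaves the mean matrix a I. *)
Lemma mean_step n i (f : T -> R) : factors (history n) f ->
  \int[P]_w (X n.+2 w i ord0 * f w) =
  a / n.+1%:R * \int[P]_w (Spos X n.+1 w i ord0 * f w).
Proof.
move=> af; have mh := @measurable_history n.
pose g (j : 'I_n.+1 * ('I_d * bool)) w :=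
  (step_mx j.2 *m X j.1.+1 w) i ord0 * f w.
have ag j : factors (history n) (g j).
  by move=> w w' e; rewrite /g (af _ _ e) (@factors_step n j.1 _ w w' e)// -ltnS.
transitivity (\int[P]_w \sum_j \1_(@event n j) w * g j w).
  apply: eq_Rintegral => w _; rewrite step_decomposition summxE mulr_suml.
  by apply: eq_bigr => j _; rewrite mxE mulrA.
rewrite Rintegral_sum; last by move=> j; exact: (integrable_indicM P mh).
transitivity (\int[P]_w \sum_j n.+1%:R^-1 * mu j.2 * g j w).
  rewrite Rintegral_sum => [|j]; last first.
    by apply: (integrable_factors P mh) => w w' /ag ->.
  apply: eq_bigr => j _.
  rewrite (Rintegral_indicM mh (measurable_event j) (event_indep j) (ag j)).
  rewrite RintegralZl//; last exact: (integrable_factors P mh).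
  by rewrite prob_event.
rewrite -RintegralZl//; last first.
  apply: (integrable_factors P mh) => w w' e.
  by rewrite (factors_position e) (af _ _ e).
apply: eq_Rintegral => w _.
have aE : a = p - q.
  rewrite /a /q; field.
  have : 1 <= d%:R :> R by rewrite ler1n.
  by move=> d1; rewrite gt_eqF//; lra.
transitivity (n.+1%:R^-1 *
    (\sum_(k < n.+1) ((\sum_u mu u *: step_mx u) *m X k.+1 w) i ord0) * f w).
  rewrite (eq_bigr (fun k : 'I_n.+1 =>
    \sum_u mu u * (step_mx u *m X k.+1 w) i ord0)).
    rewrite pair_bigA /= mulr_sumr mulr_suml; apply: eq_bigr => j _.
    by rewrite /g !mulrA.
  move=> k _; rewrite mulmx_suml summxE; apply: eq_bigr => u _.
  by rewrite -scalemxAl mxE.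
rewrite (sum_step_mx d_gt0 (p := p) (q := q))// -aE.
under eq_bigr do rewrite mul_scalar_mx mxE.
rewrite -mulr_sumr /Spos summxE big_add1 /= big_mkord.
by ring.
Qed.

(** * The rescaled coordinates as L^2-bounded martingales *)

Hypothesis a_gt : 1 / 2 < a.

Definition scaled_position i n w := Spos X n.+1 w i ord0 / growth a n.

Lemma factors_scaled_position i n : factors (history n) (scaled_position i n).
Proof. by move=> w w' e; rewrite /scaled_position (factors_position e). Qed.

Let a_ge0 : 0 <= a.
Proof. by rewrite ltW// (lt_trans _ a_gt)// divr_gt0. Qed.

Let growth_neq0 n : growth a n != 0.
Proof. by rewrite gt_eqF// growth_gt0. Qed.

(** Since gamma_(n+2) = gamma_(n+1) (1 + a / (n + 1)), the increment is a multiple of the step minus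
    its conditional mean. *)
Lemma scaled_position_increment i n w :
  scaled_position i n.+1 w - scaled_position i n w =
  (growth a n.+1)^-1 *
    (X n.+2 w i ord0 - a / n.+1%:R * Spos X n.+1 w i ord0).
Proof.
have n0 : 0 < n.+1%:R :> R by [].
rewrite /scaled_position {1}/Spos big_nat_recr//= -/(Spos X n.+1 w) mxE growthS.
move: (n.+1%:R : R) n0 (a) a_ge0 (growth a n) (growth_neq0 n).
by move=> m m0 r r0 g g0; field; rewrite g0 /= !gt_eqF//; lra.
Qed.

Let integrable_history n (f : T -> R) : factors (history n) f ->
  P.-integrable setT (EFin \o f).
Proof. exact/integrable_factors/measurable_history. Qed.

Lemma scaled_position_martingale i n (f : T -> R) : factors (history n) f ->
  \int[P]_w ((scaled_position i n.+1 w - scaled_position i n w) * f w) = 0.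
Proof.
move=> af; have af' : factors (history n.+1) f.
  by move=> w w' /factors_history; exact: af.
have aX : factors (history n.+1) (fun w => X n.+2 w i ord0 * f w).
  by move=> w w' e; rewrite (af' _ _ e) (factors_step (leqnn n.+1) e).
have aS : factors (history n) (fun w => Spos X n.+1 w i ord0 * f w).
  by move=> w w' e; rewrite (af _ _ e) (factors_position e).
have iX := integrable_history aX; have iS := integrable_history aS.
under eq_Rintegral do
  rewrite scaled_position_increment -(mulrA (growth _ _)^-1) mulrBl
    -(mulrA (a / _)).
rewrite RintegralZl//; last first.
  apply: (@integrable_history n.+1) => w w' e.
  by rewrite (aX _ _ e) (aS _ _ (factors_history e)).
rewrite RintegralB//; last first.
  by apply: (@integrable_history n) => w w' e; rewrite (aS _ _ e).
by rewrite RintegralZl// mean_step// subrr mulr0.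
Qed.

Lemma step_sqr_le1 k w i : (0 < k)%N -> X k w i ord0 ^+ 2 <= 1.
Proof.
by move=> /(@step_pm k w)/pm_basisP[u ->]; exact: signed_basis_sqr_le1.
Qed.

Lemma scaled_position_increment_moment i n :
  \int[P]_w (scaled_position i n.+1 w - scaled_position i n w) ^+ 2 <=
  (growth a n.+1 ^+ 2)^-1.
Proof.
pose D w := scaled_position i n.+1 w - scaled_position i n w.
(* With s the conditional mean and x the step, adding the vanishing integral against [m] turns (x -
   s)^2 into x^2 - s^2, which is at most 1. *)
pose m w := 2 * (a / n.+1%:R * Spos X n.+1 w i ord0 / growth a n.+1).
have aD : factors (history n.+1) D.
  move=> w w' e; rewrite /D (factors_scaled_position i e).
  by rewrite (factors_scaled_position i (factors_history e)).
have am : factors (history n) m.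
  by move=> w w' e; rewrite /m (factors_position e).
have am' : factors (history n.+1) m by move=> w w' /factors_history; exact: am.
rewrite -[leLHS]addr0 -(scaled_position_martingale i am) -RintegralD//;
  last 2 first.
- apply: (@integrable_history n.+1) => w w' e.
  by have := aD _ _ e; rewrite /D => ->.
- apply: (@integrable_history n.+1) => w w' e.
  by have := aD _ _ e; rewrite /D => ->; rewrite (am' _ _ e).
rewrite -[leRHS]mulr1 -[X in _ * X](_ : fine (P setT) = 1); last first.
  by rewrite probability_setT.
rewrite -Rintegral_cst//; apply: le_Rintegral => //.
- apply: (@integrable_history n.+1) => w w' e.
  by have := aD _ _ e; rewrite /D => ->; rewrite (am' _ _ e).
- exact: finite_measure_integrable_cst.
- move=> w _; rewrite scaled_position_increment /m.
  set s := a / n.+1%:R * _; set g := (growth a n.+1)^-1; set x := X n.+2 w i ord0.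
  have x1 : x ^+ 2 <= 1 by exact: step_sqr_le1.
  rewrite -exprVn -/g -[leRHS]mulr1.
  have -> : (g * (x - s)) ^+ 2 + g * (x - s) * (2 * (s * g)) =
      g ^+ 2 * (x ^+ 2 - s ^+ 2) by ring.
  by rewrite ler_wpM2l ?sqr_ge0// (le_trans _ x1)// gerBl sqr_ge0.
Qed.

Lemma scaled_position_bounded i :
  has_ubound (range (fun n => \int[P]_w (scaled_position i n w) ^+ 2)).
Proof.
(* The 1 bounds the second moment of the first step, the rest the sum over all increments. *)
exists (1 + (2 * a - 1)^-1) => _ [n _ <-].
apply: (@le_trans _ _ (1 + \sum_(k < n) (growth a k.+1 ^+ 2)^-1)); last first.
  by rewrite lerD2l sum_growth_sqrV.
elim: n => [|n ih].
  rewrite big_ord0 addr0 -[leRHS]mulr1 -[X in _ * X](_ : fine (P setT) = 1);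
    last by rewrite probability_setT.
  rewrite -Rintegral_cst//; apply: le_Rintegral => //.
  - apply: (@integrable_history 0%N) => w w' e.
    by rewrite (factors_scaled_position i e).
  - exact: finite_measure_integrable_cst.
  - move=> w _; rewrite /scaled_position growth0 divr1 /Spos big_nat1.
    exact: step_sqr_le1.
rewrite big_ord_recr /= addrA.
rewrite (martingale_second_momentS (@measurable_history) factors_history
  (factors_scaled_position i) (scaled_position_martingale i)).
by rewrite lerD// scaled_position_increment_moment.
Qed.

Lemma measurable_scaled_position i n : measurable_fun setT (scaled_position i n).
Proof.
by have /integrableP[/measurable_EFinP] :=
  integrable_history (@factors_scaled_position i n).
Qed.

Lemma scaled_position_limit i : exists L : T -> R,
  [/\ measurable_fun setT L,
      {ae P, forall w, scaled_position i ^~ w @ \oo --> L w},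
      forall (c : nat -> R) (k : R), c @ \oo --> k ->
        (\int[P]_w ((c n * scaled_position i n w - k * L w) ^+ 2)%:E)%E
          @[n --> \oo] --> 0%E &
      forall c : R, P [set w | L w = c] = 1%E ->
        \int[P]_w (X 1%N w i ord0 - c) ^+ 2 = 0].
Proof.
have mH := @measurable_history; have filtH := @factors_history.
have adM := @factors_scaled_position i; have maM := @scaled_position_martingale i.
have bdM := scaled_position_bounded i.
exists (martingale_limit (scaled_position i)); split.
- exact: (measurable_martingale_limit P mH adM).
- exact: (martingale_limit_ae_cvg mH filtH adM maM bdM).
- exact: (martingale_scaled_L2_cvg mH filtH adM maM bdM).
- move=> c /(martingale_limit_cst mH filtH adM maM bdM) <-.
  apply: eq_Rintegral => w _.
  by rewrite /scaled_position growth0 divr1 /Spos big_nat1.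
Qed.

End elephant_random_walk.

(** * From the coordinates to the random vector *)

Lemma cvg_cV (R : realType) (d : nat) (u : nat -> 'cV[R]_d) (l : 'cV[R]_d) :
  (forall i, u n i ord0 @[n --> \oo] --> l i ord0) -> u @ \oo --> l.
Proof.
move=> ul; apply/cvg_ballP => e e0.
have : \forall n \near \oo, forall i, ball (l i ord0) e (u n i ord0).
  by apply: filter_forall => i; exact: (cvg_ball (ul i)).
by apply: filterS => n h; split=> // i j; rewrite ord1; exact: h.
Qed.

Theorem theorem3p7 (R : realType) (dsp : measure_display) (T : measurableType dsp)
  (P : probability T R) (d : nat) (p : R)
  (X : nat -> T -> 'cV[R]_d) (b : nat -> T -> nat) (A : nat -> T -> 'M[R]_d) :
  (0 < d)%N ->
  (2 * d%:R + 1) / (4 * d%:R) < p -> p <= 1 ->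
  (* X_1 uniform on {+-e_1, ..., +-e_d} *)
  (forall w, X 1%N w \in pm_basis R d) ->
  (forall v, measurable [set w | X 1%N w = v]) ->
  (forall i : 'I_d, P [set w | X 1%N w = ebasis R i] = ((2 * d%:R)^-1)%:E) ->
  (forall i : 'I_d, P [set w | X 1%N w = - ebasis R i] = ((2 * d%:R)^-1)%:E) ->
  (* b_n uniform on {1, ..., n} *)
  (forall n w, (0 < n)%N -> (1 <= b n w <= n)%N) ->
  (forall n k, measurable [set w | b n w = k]) ->
  (forall n k, (1 <= k <= n)%N -> P [set w | b n w = k] = (n%:R^-1)%:E) ->
  (* A_n = I w.p. p, and each of -I, +-J, ..., +-J^(d-1) w.p. (1-p)/(2d-1) *)
  (forall n w, (0 < n)%N -> A n w \in A_values R d) ->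
  (forall n M, measurable [set w | A n w = M]) ->
  (forall n, (0 < n)%N -> P [set w | A n w = 1%:M] = p%:E) ->
  (forall n, (0 < n)%N ->
     P [set w | A n w = - 1%:M] = ((1 - p) / (2 * d%:R - 1))%:E) ->
  (forall n k, (0 < n)%N -> (1 <= k < d)%N ->
     P [set w | A n w = Jmat R d ^+ k] = ((1 - p) / (2 * d%:R - 1))%:E) ->
  (forall n k, (0 < n)%N -> (1 <= k < d)%N ->
     P [set w | A n w = - Jmat R d ^+ k] = ((1 - p) / (2 * d%:R - 1))%:E) ->
  (* b_n, A_n and F_n = sigma(X_1, ..., X_n) are mutually independent *)
  (forall n (K : set nat) (C : set 'M[R]_d) (B : set ('I_n -> 'cV[R]_d)),
     (0 < n)%N ->
     P ((b n) @^-1` K `&` (A n) @^-1` C `&` (hist X n) @^-1` B) =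
     (P ((b n) @^-1` K) * P ((A n) @^-1` C) * P ((hist X n) @^-1` B))%E) ->
  (* X_{n+1} = A_n X_{b_n} *)
  (forall n w, (0 < n)%N -> X n.+1 w = A n w *m X (b n w) w) ->
  let a := (2 * d%:R * p - 1) / (2 * d%:R - 1) in
  exists L : T -> 'cV[R]_d,
    (forall i : 'I_d, measurable_fun setT (fun w => L w i ord0)) /\
    (* L is non-degenerate: not almost surely constant *)
    ~ (exists c : 'cV[R]_d, P [set w | L w = c] = 1%E) /\
    {ae P, forall w,
       (fun n : nat => ((n%:R `^ a)^-1) *: Spos X n w) @ \oo --> L w} /\
    (fun n : nat =>
       (\int[P]_w (\sum_(i < d)
          ((((n%:R `^ a)^-1) *: Spos X n w - L w) i ord0) ^+ 2)%:E)%E)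
      @ \oo --> 0%E.
Proof.
move=> d0 pd p1 X1_pm mX1 PX1 PX1N b_range mb Pb A_range mA PA1 PAN1 PAJ PANJ.
move=> indep XS a.
have d1 : 1 <= d%:R :> R by rewrite ler1n.
(* The threshold (2d + 1) / (4d) is the value of p for which a = 1/2. *)
have a_gt : 1 / 2 < a.
  move: pd; rewrite /a ltr_pdivrMr; last by lra.
  by rewrite ltr_pdivlMr; [lra|lra].
have a_le1 : a <= 1.
  rewrite /a ler_pdivrMr; last by lra.
  by rewrite mul1r lerD2r ler_piMr//; lra.
have [k k0 ck] : exists2 k : R, 0 < k &
    growth a n / n.+1%:R `^ a @[n --> \oo] --> k.
  by apply: growth_powR_cvg; rewrite a_le1 andbT; lra.
pose c n := growth a n / n.+1%:R `^ a.
have /choice[L HL] := scaled_position_limit d0 X1_pm mX1 b_range mb Pb A_range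
  mA PA1 PAN1 PAJ PANJ indep XS a_gt.
have scaledE n w i : (((n.+1%:R `^ a)^-1) *: Spos X n.+1 w) i ord0 =
    c n * scaled_position p X i n w.
  rewrite mxE /c /scaled_position -/a; field.
  by rewrite !gt_eqF ?powR_gt0 ?growth_gt0//; lra.
(* By [scaledE], S_(n+1) / (n+1)^a is [c n] times the martingale, and [c n] tends to [k]. *)
exists (fun w => \col_i (k * L i w)); split; [|split; [|split]].
- move=> i; have [mL _ _ _] := HL i.
  by under eq_fun do rewrite mxE; exact: measurable_funM.
(* A constant limit would give E (X_1 - r)^2 = 0 in the first coordinate, although X_1 takes both
   e_1 and -e_1 with positive probability, forcing r = 1 and r = -1. *)
- move=> [v Pv]; pose i := Ordinal d0; have [mL _ _ cstL] := HL i.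
  pose r := v i ord0 / k.
  have mLr : measurable [set w | L i w = r].
    by have := mL measurableT _ (measurable_set1 r); rewrite setTI.
  have mLv : measurable [set w | (\col_i (k * L i w)) = v].
    have -> : [set w | (\col_i (k * L i w)) = v] =
        \bigcap_(j in [set: 'I_d]) [set w | L j w = v j ord0 / k].
      apply/seteqP; split => [w /= <- j _|w /= h].
        by rewrite /= mxE [k * _]mulrC mulfK ?gt_eqF.
      by apply/colP => j; rewrite mxE h// mulrC divfK ?gt_eqF.
    apply: fin_bigcap_measurable => // j _; have [mLj _ _ _] := HL j.
    by have := mLj measurableT _ (measurable_set1 (v j ord0 / k)); rewrite setTI.
  have Pr : P [set w | L i w = r] = 1%E.
    apply/eqP; rewrite eq_le probability_le1//= -Pv; apply: le_measure;
      rewrite ?inE//.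
    by move=> w /= vE; rewrite /r -vE mxE [k * _]mulrC mulfK ?gt_eqF.
  have int0 := cstL _ Pr.
  have iX : P.-integrable setT (EFin \o fun w => (X 1%N w i ord0 - r) ^+ 2).
    apply: (integrable_factors P
      (measurable_history d0 X1_pm mX1 b_range mb A_range mA XS (n := 0%N))).
    by move=> w w' /(factors_step X1_pm b_range A_range XS (leqnn 0)) ->.
  (* An atom x of X_1 contributes (x_i - r)^2 / (2d) to an integral equal to 0. *)
  have atom (x : 'cV[R]_d) : P [set w | X 1%N w = x] = ((2 * d%:R)^-1)%:E ->
      r = x i ord0.
    move=> Px; apply/esym/eqP; rewrite -subr_eq0 -sqrf_eq0 eq_le sqr_ge0 andbT.
    have dV : 0 < (2 * d%:R)^-1 :> R by rewrite invr_gt0; lra.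
    rewrite -(ler_pM2r dV) mul0r -int0.
    rewrite -[X in _ * X]/(fine ((2 * d%:R)^-1)%:E) -Px -Rintegral_indic//.
    rewrite -RintegralZl//; last exact: integrable_indic.
    apply: le_Rintegral => //.
      rewrite (_ : _ \o _ = fun w => (((x i ord0 - r) ^+ 2)%:E *
        (\1_[set w | X 1%N w = x] w)%:E)%E)//.
      by apply: integrableZl => //; exact: integrable_indic.
    move=> w _; rewrite indicE; have [|] := boolP (w \in _).
      by rewrite inE /= => ->; rewrite mulr1.
    by rewrite mulr0 sqr_ge0.
  have := atom _ (PX1 i); rewrite (atom _ (PX1N i)) !mxE !eqxx /=; lra.
- have : {ae P, forall w, forall i,
      scaled_position p X i ^~ w @ \oo --> L i w}.
    by apply: filter_forall => i; have [] := HL i.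
  (* The term n = 0 is dropped because [scaled_position] at n uses S_(n+1). *)
  apply: filterS => w cw; rewrite -cvg_shiftS; apply: cvg_cV => i.
  under eq_cvg do rewrite scaledE.
  by rewrite mxE; apply: cvgM => //; exact: cw.
- rewrite -[X in _ --> X](_ : \sum_(i < d) 0 = 0)%E; last by rewrite big1.
  rewrite -cvg_shiftS.
  have -> : (fun n => \int[P]_w (\sum_(i < d)
      ((((n.+1%:R `^ a)^-1) *: Spos X n.+1 w - \col_i (k * L i w)) i ord0)
        ^+ 2)%:E)%E =
    (fun n => \sum_(i < d) \int[P]_w
      ((c n * scaled_position p X i n w - k * L i w) ^+ 2)%:E)%E.
    apply/funext => n; rewrite -ge0_integral_sum//=.
    + apply: eq_integral => w _; rewrite sumEFin; congr EFin.
      by apply: eq_bigr => i _; rewrite mxE scaledE !mxE.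
    + move=> i; have [mL _ _ _] := HL i.
      apply/measurable_EFinP; apply: measurable_funX.
      apply: measurable_funB; apply: measurable_funM => //.
      exact: (measurable_scaled_position P p d0 X1_pm mX1 b_range mb A_range
        mA XS).
    + by move=> i w _; rewrite lee_fin sqr_ge0.
  apply: cvg_nnesum => i _.
    by apply: nearW => n; apply: integral_ge0 => w _; rewrite lee_fin sqr_ge0.
  by have [_ _ L2 _] := HL i; exact: L2.
Qed.
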